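(* Let $A=(a_n)_{n\ge1}$ be an infinite sequence of integers with the infinite complementary property. Then $$\mathrm{SR}_3(A)=\{x_1+\dots+x_{3k} : k\in\mathbb{N},\ x_1,\dots,x_{3k}\in A,\ x_i\ne x_j \text{ for } i\neq j\}.$$ Furthermore, this set is an additive subgroup of $\mathbb{Z}$.
   Context: For a sequence $A=(a_n)_{n\ge 1}$ of real numbers, the $3n$-sum range $\mathrm{SR}_3(A)$ is the set of all $x\in\mathbb{R}$ for which there is a permutation (bijection) $\pi$ of $\{1,2,\dots\}$ such that $\lim_{k\to\infty}\sum_{n=1}^{3k}a_{\pi(n)}=x$. We write $x\in A$ if $x$ occurs as a term of the sequence. $A$ has the infinite complementary property (ICP) if for every $a\in A$ there are infinitely many pairs $\{b,c\}$ of distinct numbers $b,c\in A$ with $a+b+c=0$. *)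

(* Defs.v *)
From HB Require Import structures.
From mathcomp Require Import all_boot all_order all_algebra.
From mathcomp Require Import all_classical all_reals all_analysis.
Import Order.TTheory GRing.Theory Num.Theory.
Import numFieldNormedType.Exports.

Set Implicit Arguments.
Unset Strict Implicit.
Unset Printing Implicit Defensive.

Local Open Scope classical_set_scope.
Local Open Scope ring_scope.

(* Sequences are indexed from 0, so [range a] is the set of terms of [a] and
   the sum of the first 3k terms runs over 0 <= n < 3k. *)

Definition SR3 (R : realType) (a : nat -> R) : set R :=
  [set x | exists pi : nat -> nat, bijective pi /\
     (\sum_(0 <= n < (3 * k)%N) a (pi n)) @[k --> \oo] --> x].

(* The pairs {b, c} are unordered, hence two-element sets of values. *)
Definition ICP (R : realType) (a : nat -> R) : Prop :=
  forall x, range a x ->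
    infinite_set [set p : set R | exists b c : R,
      [/\ range a b, range a c, b <> c, x + b + c = 0 & p = [set b; c]]].

(* k ranges over the positive integers: the empty sum is not included. *)
Definition distinct_sums3 (R : realType) (a : nat -> R) : set R :=
  [set s | exists (k : nat) (x : 'I_(3 * k) -> R),
     [/\ (0 < k)%N, forall i, range a (x i), injective x
       & s = \sum_(i < (3 * k)%N) x i]].

(* Main.v *)
Require Import Defs.
From HB Require Import structures.
From mathcomp Require Import all_boot all_order all_algebra.
From mathcomp Require Import all_classical all_reals all_analysis.
Import Order.TTheory GRing.Theory Num.Theory.
Import numFieldNormedType.Exports.
From mathcomp Require Import ring.

Set Implicit Arguments.
Unset Strict Implicit.
Unset Printing Implicit Defensive.

Local Open Scope classical_set_scope.
Local Open Scope ring_scope.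

(* The ICP writes any term x as a sum of four terms avoiding a given finite set,
   so a sum of 3k terms, with repetitions allowed, is also a sum of 12k distinct
   terms; since -x is a sum of two terms, these sums form a group. A convergent
   sequence of integers attains its limit, so every element of SR3 is a sum of
   3k terms. Conversely, start with indices of the given distinct terms and
   repeatedly append the least unused index m with unused indices p, q such that
   a_m + a_p + a_q = 0: all indices get used, and the partial sums over
   multiples of 3 are eventually constant. *)

Lemma exists_least_missing (s : seq nat) :
  exists m, m \notin s /\ forall j, (j < m)%N -> j \in s.
Proof.
have ex : exists m, m \notin s.
  apply: contrapT => /forallNP all_in.
  have /(uniq_leq_size (iota_uniq 0 (size s).+1)) :
      {subset iota 0 (size s).+1 <= s}.
    by move=> x _; apply/negPn/negP.
  by rewrite size_iota ltnn.
case: (ex_minnP ex) => m ms minm; exists m; split=> // j jm.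
by apply: contraLR jm => /minm; rewrite -leqNgt.
Qed.

(** Each stage appends a block holding the least missing index, so stage [i] contains every index
    below [i], whence surjectivity. The stages are duplicate-free prefixes of one another, whence
    injectivity. *)
Lemma greedy_permutation (P : seq nat -> Prop) (d : nat) (s0 : seq nat) :
    (0 < d)%N -> (forall s, P s -> uniq s) -> P s0 ->
    (forall s m, P s -> m \notin s ->
      exists t, [/\ size t = d, m \in t & P (s ++ t)]) ->
  exists2 pi, bijective pi & forall i, P (mkseq pi (size s0 + i * d)).
Proof.
move=> d0 Puniq Ps0 extend.
(* The last clause describes the least missing index without naming it, ready for the induction in
   [cover]. *)
have /choice[f fP] : forall s, exists t, P s -> [/\ size t = d, P (s ++ t) &
    forall m, (forall j, (j < m)%N -> j \in s) -> m \in s ++ t].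
  move=> s; have [Ps|nPs] := pselect (P s); last by exists [::].
  have [m [ms minm]] := exists_least_missing s.
  have [t [szt mt Pst]] := extend _ _ Ps ms; exists t => _; split=> // n ltn_in.
  rewrite mem_cat; have [//|ns /=] := boolP (n \in s).
  suff -> : n = m by [].
  case: (ltngtP n m) => // [/minm|/ltn_in]; first by rewrite (negPf ns).
  by rewrite (negPf ms).
pose st i := iter i (fun s => s ++ f s) s0.
have stS i : st i.+1 = st i ++ f (st i) by [].
have Pst i : P (st i) by elim: i => // i /fP[].
have szst i : size (st i) = (size s0 + i * d)%N.
  elim: i => [|i IH]; first by rewrite addn0.
  by rewrite stS size_cat IH; have [-> _ _] := fP _ (Pst i); rewrite mulSn addnAC addnA.
have nth_st i k n : (n < size (st i))%N -> nth 0%N (st (k + i)%N) n = nth 0%N (st i) n.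
  move=> ni; elim: k => // k IH; rewrite addSn stS nth_cat IH ifT //.
  by apply: leq_trans ni _; rewrite !szst leq_add2l leq_mul2r leq_addl orbT.
(* Since [d] is positive, stage [n.+1] is long enough to have a position [n]; the default is never
   read. *)
pose pi n := nth 0%N (st n.+1) n.
have n_lt n : (n < size (st n.+1))%N.
  by rewrite szst (leq_trans _ (leq_addl _ _)) // leq_pmulr.
have piE i n : (n < size (st i))%N -> pi n = nth 0%N (st i) n.
  move=> ni; rewrite -(nth_st _ n.+1 _ ni) addnC; exact/esym/nth_st.
have mkpi i : mkseq pi (size s0 + i * d) = st i.
  apply: (@eq_from_nth _ 0%N); rewrite size_mkseq ?szst // => n ni.
  by rewrite nth_mkseq // (piE i) ?szst.
exists pi; last by move=> i; rewrite mkpi.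
rewrite -setTT_bijective; split => //.
  move=> m n _ _ pimn.
  wlog mn : m n pimn / (m <= n)%N => [hw|].
    by case/orP: (leq_total m n) => /hw; [exact | move/(_ (esym pimn))].
  apply/eqP; rewrite -(nth_uniq 0%N (leq_ltn_trans mn (n_lt n)) (n_lt n)) ?Puniq //.
  by rewrite -!(piE n.+1) ?pimn ?(leq_ltn_trans mn).
move=> m _.
have cover i j : (j < i)%N -> j \in st i.
  elim: i j => // i IH j; rewrite ltnS leq_eqVlt => /orP[/eqP ->|/IH ji].
    by have [_ _] := fP _ (Pst i); apply.
  by rewrite stS mem_cat ji.
have /(nthP 0%N)[n nm <-] := cover m.+1 m (ltnSn m).
by exists n => //; exact: piE.
Qed.

(** Two integers both within 1/2 of the limit are less than 1 apart, hence equal. *)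
Lemma int_cvg_attained (R : realType) (u : nat -> R) (x : R) :
  (forall n, u n \is a Num.int) -> u k @[k --> \oo] --> x ->
  exists2 k, (0 < k)%N & u k = x.
Proof.
move=> u_int /cvgrPdist_lt ux.
have half0 : (0 : R) < 2^-1 by rewrite invr_gt0.
have [N _ HN] := ux _ half0.
(* [N.+1] instead of [N] makes the index positive, as the empty sum is excluded. *)
have [<-|xN] := eqVneq (u N.+1) x; first by exists N.+1.
have e0 : 0 < `|x - u N.+1| by rewrite normr_gt0 subr_eq0 eq_sym.
have [M _ HM] := ux _ e0.
have := HM (maxn M N) (leq_maxl _ _); have := HN (maxn M N) (leq_maxr _ _).
have := HN N.+1 (leqnSn N) => /=; set v := u (maxn M N) => h1 h2 h3.
suff uv : u N.+1 - v = 0 by move: h3; rewrite -(subr0_eq uv) ltxx.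
apply/eqP/contraT => /norm_intr_ge1; rewrite rpredB ?u_int// => /(_ isT).
rewrite leNgt distrC -(subrKA x) (le_lt_trans (ler_normD _ _))//.
by rewrite (splitr 1) div1r ltrD// distrC.
Qed.

Section ICPSums.
Variables (R : realType) (a : nat -> R).
Hypothesis a_icp : ICP a.

(** A pair with sum [- x] is determined by either member, so only finitely many pairs meet [F]. *)
Lemma ICP_fresh (F : seq R) (x : R) : range a x ->
  exists b c, [/\ range a b, range a c, b != c, b \notin F /\ c \notin F & x + b + c = 0].
Proof.
move=> /a_icp; apply: contra_notP => /forallNP noF.
apply: (@sub_finite_set _ _ ((fun b => [set b; - x - b]) @` [set` F])); last first.
  exact/finite_image/finite_seq.
move=> _ /= [b [c [ab ac bc xbc ->]]].
have cE : c = - x - b by apply/eqP; rewrite -subr_eq0 -xbc; apply/eqP; ring.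
have bE : b = - x - c by rewrite cE; ring.
have [bF|bF] := boolP (b \in F); first by exists b => //=; rewrite -cE.
have [cF|cF] := boolP (c \in F); first by exists c => //=; rewrite -bE setUC.
exfalso; apply: (noF b); exists c; split=> //; exact/eqP.
Qed.

Lemma distinct_sums3P (x : R) : distinct_sums3 a x <-> exists r : seq R,
  [/\ (0 < size r)%N /\ (3 %| size r)%N, uniq r, {in r, forall y, range a y}
    & x = \sum_(y <- r) y].
Proof.
split=> [[k [y [k0 ya y_inj ->]]]|[r [[r0 /dvdnP[k rk]] r_uniq ra ->]]].
  exists [seq y i | i <- enum 'I_(3 * k)]; split.
  - by rewrite size_map -cardE card_ord muln_gt0 dvdn_mulr.
  - by rewrite map_inj_uniq // enum_uniq.
  - by move=> _ /mapP[i _ ->].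
  - by rewrite big_map big_enum.
rewrite mulnC in rk; exists k, (fun i => nth 0 r i); split.
- by move: r0; rewrite rk muln_gt0.
- by move=> i; apply: ra; rewrite mem_nth // rk.
- by move=> i j /eqP; rewrite nth_uniq ?rk // => /eqP /val_inj.
- by rewrite (big_nth 0) big_mkord rk.
Qed.

(* Applying the ICP to [x], then to both [b] and [c], gives
   [x = - b - c = (b1 + c1) + (b2 + c2)]: a term is traded for four fresh
   terms, which does not change the number of terms modulo 3. *)
Lemma ICP_sum4 (F : seq R) (x : R) : range a x -> uniq F ->
  exists r, [/\ size r = 4%N, {in r, forall y, range a y}, uniq (r ++ F)
    & \sum_(y <- r) y = x].
Proof.
move=> xa F_uniq; have [b [c [ba ca _ _ xbc]]] := ICP_fresh [::] xa.
have [b1 [c1 [b1a c1a n1 [b1F c1F] e1]]] := ICP_fresh F ba.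
have [b2 [c2 [b2a c2a n2 [b2F c2F] e2]]] := ICP_fresh [:: b1, c1 & F] ca.
exists [:: b2; c2; b1; c1]; split => //.
- by move=> y; rewrite !inE => /or4P[] /eqP ->.
- by rewrite /= in_cons negb_or n2 b2F c2F in_cons negb_or n1 b1F c1F.
- rewrite !big_cons big_nil; apply/eqP; rewrite -subr_eq0; apply/eqP.
  have -> : b2 + (c2 + (b1 + (c1 + 0))) - x =
    (b + b1 + c1) + (c + b2 + c2) - (x + b + c) by ring.
  by rewrite e1 e2 xbc; ring.
Qed.

(** Once repetitions are harmless, closure properties reduce to concatenating lists. *)
Lemma sum_in_distinct_sums3 (r : seq R) : (0 < size r)%N -> (3 %| size r)%N ->
  {in r, forall y, range a y} -> distinct_sums3 a (\sum_(y <- r) y).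
Proof.
move=> r0 r3 ra; apply/distinct_sums3P.
have [r' [szr' r'_uniq r'a sum_r']] : exists r', [/\ size r' = (4 * size r)%N,
    uniq r', {in r', forall y, range a y} & \sum_(y <- r') y = \sum_(y <- r) y].
  elim: r ra {r0 r3} => [|x r IH] ra; first by exists [::]; rewrite !big_nil.
  have [|r' [szr' r'_uniq r'a sum_r']] := IH.
    by move=> y yr; apply: ra; rewrite in_cons yr orbT.
  have [q [szq qa qr'_uniq sum_q]] := ICP_sum4 (ra _ (mem_head _ _)) r'_uniq.
  exists (q ++ r'); split=> //; first by rewrite size_cat szq szr' mulnS.
    by move=> y; rewrite mem_cat => /orP[/qa|/r'a].
  by rewrite big_cat big_cons sum_q sum_r'.
by exists r'; rewrite szr' muln_gt0 dvdn_mull.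
Qed.

Lemma distinct_sums3_zmod_closed : zmod_closed [pred x | x \in distinct_sums3 a].
Proof.
have opp z : distinct_sums3 a z -> distinct_sums3 a (- z).
  move=> /distinct_sums3P[r [[r0 r3] _ ra ->]].
  have [q [szq qa <-]] : exists q, [/\ size q = (2 * size r)%N,
      {in q, forall y, range a y} & \sum_(y <- q) y = - \sum_(y <- r) y].
    elim: r ra {r0 r3} => [|x r IH] ra; first by exists [::]; rewrite !big_nil oppr0.
    have [|q [szq qa sum_q]] := IH.
      by move=> y yr; apply: ra; rewrite in_cons yr orbT.
    have [b [c [ba ca _ _ xbc]]] := ICP_fresh [::] (ra _ (mem_head _ _)).
    exists [:: b, c & q]; split; first by rewrite /= szq mulnS.
      by move=> y; rewrite !in_cons => /or3P[/eqP->|/eqP->|/qa].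
    rewrite !big_cons sum_q; apply/eqP; rewrite -subr_eq0 -xbc; apply/eqP; ring.
  by apply: sum_in_distinct_sums3; rewrite // szq ?muln_gt0 ?dvdn_mull.
split=> [|x y]; rewrite !inE.
  have a0 : range a (a 0%N) by exists 0%N.
  have [b [c [ba ca _ _ abc]]] := ICP_fresh [::] a0.
  have -> : 0 = \sum_(y <- [:: a 0%N; b; c]) y :> R.
    by rewrite !big_cons big_nil addr0 addrA abc.
  apply: sum_in_distinct_sums3 => // y; rewrite !inE.
  by move=> /or3P[] /eqP ->.
move=> /distinct_sums3P[r [[r0 r3] _ ra ->]].
move=> /opp/distinct_sums3P[q [[q0 q3] _ qa ->]].
rewrite -big_cat; apply: sum_in_distinct_sums3.
- by rewrite size_cat addn_gt0 r0.
- by rewrite size_cat dvdn_add.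
- by move=> z; rewrite mem_cat => /orP[/ra|/qa].
Qed.

Lemma distinct_sums3_sub_SR3 : distinct_sums3 a `<=` SR3 a.
Proof.
move=> x /distinct_sums3P[r [[_ /dvdnP[k rk]] r_uniq ra xE]].
have /choice[f fK] : forall y, exists n, range a y -> a n = y.
  by move=> y; have [[n _ <-]|ny] := pselect (range a y); [exists n | exists 0%N].
pose P s := uniq s /\ \sum_(n <- s) a n = x.
have P0 : P (map f r).
  split; last by rewrite big_map xE; apply: eq_big_seq => y /ra /fK.
  rewrite map_inj_in_uniq // => y z /ra/fK yE /ra/fK zE yz.
  by rewrite -yE yz.
have [|s m [s_uniq s_sum] ms|pi pi_bij piP] :=
    greedy_permutation (P := P) (isT : (0 < 3)%N) _ P0.
- by move=> s [].
- have am : range a (a m) by exists m.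
  (* Avoiding the values of [a] on [m :: s] forces the indices [p] and [q] to be new. *)
  have [_ [_ [[p _ <-] [q _ <-] pq [pF qF] mpq]]] := ICP_fresh (map a (m :: s)) am.
  have fresh n : a n \notin map a (m :: s) -> n \notin m :: s.
    by apply: contra => ns; exact: map_f.
  exists [:: m; p; q]; split; rewrite ?mem_head //; split.
    rewrite cat_uniq s_uniq /= !inE negb_or.
    move: (fresh _ pF) (fresh _ qF); rewrite !inE !negb_or.
    move=> /andP[pm ps] /andP[qm qs].
    rewrite (negPf ms) (negPf ps) (negPf qs) /= ![m == _]eq_sym pm qm !andbT /=.
    by apply: contra pq => /eqP ->.
  by rewrite big_cat !big_cons big_nil s_sum /= addr0 (addrA (a m)) mpq addr0.
exists pi; split=> //; apply: cvg_near_cst.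
(* The initial list has [3 * k] indices, so stage [n - k] consists of exactly the first [3 * n]
   values of [pi]. *)
exists k => // n /= kn; have [_] := piP (n - k)%N.
rewrite size_map rk -mulnDl subnKC // mulnC.
by rewrite big_map /index_iota subn0.
Qed.

(** The limit is a partial sum over [3 * k] distinct indices, whose values may still coincide;
    [sum_in_distinct_sums3] repairs this. *)
Lemma SR3_sub_distinct_sums3 : (forall n, a n \is a Num.int) ->
  SR3 a `<=` distinct_sums3 a.
Proof.
move=> a_int x [pi [_ cvx]].
have [|k k0 <-] := int_cvg_attained _ cvx; first by move=> n; exact: rpred_sum.
rewrite -(big_map (a \o pi) xpredT id).
apply: sum_in_distinct_sums3; rewrite ?size_map ?size_iota ?subn0 ?muln_gt0 ?dvdn_mulr //.
by move=> _ /mapP[n _ ->]; exists (pi n).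
Qed.

End ICPSums.

Theorem theorem2p3p3 (R : realType) (a : nat -> R)
    (a_int : forall n, a n \is a Num.int) (a_icp : ICP a) :
  SR3 a = distinct_sums3 a /\
  (SR3 a `<=` [set x | x \is a Num.int] /\ zmod_closed [pred x | x \in SR3 a]).
Proof.
have SR3E : SR3 a = distinct_sums3 a.
  by apply/seteqP; split; [exact: SR3_sub_distinct_sums3 | exact: distinct_sums3_sub_SR3].
rewrite SR3E; split=> //; split; last exact: distinct_sums3_zmod_closed.
move=> _ [k [x [_ xa _ ->]]] /=; apply: rpred_sum => i _.
by have [n _ <-] := xa i.
Qed.
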